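(* There is a skew left brace $(G, \cdot, \circ)$ such that $(G, \cdot) = \mathbb{Z} \wr \mathbb{Z}$ is a non-nilpotent metabelian group and $(G, \circ)$ is a free abelian group of infinite rank.
   Context: A skew left brace is a triple $(G, \cdot, \circ)$ where $(G,\cdot)$ and $(G,\circ)$ are groups and $g_1 \circ (g_2 \cdot g_3) = (g_1 \circ g_2)\cdot g_1^{-1} \cdot (g_1 \circ g_3)$ for all $g_1,g_2,g_3 \in G$, where $g_1^{-1}$ is the inverse in $(G,\cdot)$. Here $\mathbb{Z} \wr \mathbb{Z}$ is the direct (restricted) wreath product of two infinite cyclic groups, i.e. the group with presentation $\langle x, y_i\ (i \in \mathbb{Z}) \mid x^{-1} y_i x = y_{i+1},\ [y_i, y_j] = 1,\ i,j \in \mathbb{Z} \rangle$. *)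

(* Defs.v *)
From HB Require Import structures.
From mathcomp Require Import all_boot all_order all_algebra.
From mathcomp Require Import finmap.
From mathcomp Require Import boolp classical_sets functions cardinality.
From mathcomp.multinomials Require Import freeg.

Set Implicit Arguments.
Unset Strict Implicit.
Unset Printing Implicit Defensive.

Import GRing.Theory.
Local Open Scope classical_set_scope.
Local Open Scope group_scope.

HB.mixin Record Group_isSkewBrace G of Group G := {
  circ : G -> G -> G;
  circ_one : G;
  circ_inv : G -> G;
  circA : associative circ;
  circ1g : left_id circ_one circ;
  circg1 : right_id circ_one circ;
  circVg : left_inverse circ_one circ_inv circ;
  circgV : right_inverse circ_one circ_inv circ;
  circ_brace : forall g1 g2 g3 : G,
    circ g1 (g2 * g3) = circ g1 g2 * g1^-1 * circ g1 g3
}.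

(* [G : skewBraceType] is a skew left brace $(G, \cdot, \circ)$; its
   [groupType] structure is $(G, \cdot)$. *)
#[short(type="skewBraceType")]
HB.structure Definition SkewBrace := {G of Group_isSkewBrace G & Group G}.

(* The group $(G, \circ)$, on a copy of the carrier of $G$. *)
Definition circ_group (G : skewBraceType) : Type := G.

HB.instance Definition _ (G : skewBraceType) := Choice.on (circ_group G).
HB.instance Definition _ (G : skewBraceType) :=
  isGroup.Build (circ_group G)
    (@circA G) (@circ1g G) (@circg1 G) (@circVg G) (@circgV G).

Definition group_isomorphic (G H : groupType) : Prop :=
  exists f : {multiplicative G -> H}, bijective f.

Section Subgroups.
Variable G : groupType.
Implicit Types H K A : set G.

Definition is_subgroup H : Prop :=
  [/\ H 1, forall x y, H x -> H y -> H (x * y) & forall x, H x -> H x^-1].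

Definition generated A : set G := smallest is_subgroup A.

Definition commutator_subgroup H K : set G :=
  generated [set z | exists x y, [/\ H x, K y & z = commg x y]].

Fixpoint lower_central_series (n : nat) : set G :=
  if n is m.+1 then commutator_subgroup (lower_central_series m) setT
  else setT.

Definition nilpotent_group : Prop :=
  exists n, lower_central_series n = [set 1].

Definition metabelian_group : Prop :=
  forall x y, commutator_subgroup setT setT x ->
    commutator_subgroup setT setT y -> commute x y.

End Subgroups.

Arguments nilpotent_group : clear implicits.
Arguments metabelian_group : clear implicits.

(* [{freeg I}] is the free abelian group on [I], with integer coefficients. *)
Definition free_abelian_of_infinite_rank (G : groupType) : Prop :=
  exists I : choiceType, infinite_set [set: I] /\
    group_isomorphic G (Algebra.to_multiplicative {freeg I}).

(* The restricted wreath product $A \wr B$: finitely supported functions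
   $B \to A$, extended by $B$. The pair [(f, b)] stands for the product
   [f * b], and the right action of [b] on the base group is
   $f^b (u) = f (u b^{-1})$. *)
Definition wreath (A B : groupType) : Type :=
  ({fsfun B -> A with 1} * B)%type.

Section Wreath.
Variables A B : groupType.
Local Notation base := {fsfun B -> A with 1}.
Local Notation W := (wreath A B).
Implicit Types (f g : base) (p q r : W).

Definition wbase_mul f g (b : B) : base :=
  [fsfun u in (finsupp f `|` [fset v * b^-1 | v in finsupp g])%fset
     => f u * g (u * b)].

Definition wbase_inv f (b : B) : base :=
  [fsfun u in [fset v * b | v in finsupp f]%fset => (f (u * b^-1))^-1].

Lemma wbase_mulE f g b u : wbase_mul f g b u = f u * g (u * b).
Proof.
rewrite fsfunE; case: ifPn => //.
rewrite in_fsetU negb_or => /andP[/fsfun_dflt -> hg].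
rewrite mul1g fsfun_dflt//; apply: contra hg => hg.
by apply/imfsetP; exists (u * b) => //=; rewrite mulgK.
Qed.

Lemma wbase_invE f b u : wbase_inv f b u = (f (u * b^-1))^-1.
Proof.
rewrite fsfunE; case: ifPn => // hf.
rewrite fsfun_dflt ?invg1//; apply: contra hf => hf.
by apply/imfsetP; exists (u * b^-1) => //=; rewrite mulgVK.
Qed.

Definition wmul p q : W := (wbase_mul p.1 q.1 p.2, p.2 * q.2).
Definition wone : W := ([fsfun], 1).
Definition winv p : W := (wbase_inv p.1 p.2, p.2^-1).

Lemma wmulA : associative wmul.
Proof.
move=> p q r; congr pair; last exact: mulgA.
by apply/fsfunP => x; rewrite !wbase_mulE /= !mulgA.
Qed.

Lemma wmul1g : left_id wone wmul.
Proof.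
case=> f b; congr pair; last exact: mul1g.
by apply/fsfunP => x; rewrite wbase_mulE fsfun0E mul1g mulg1.
Qed.

Lemma wmulg1 : right_id wone wmul.
Proof.
case=> f b; congr pair; last exact: mulg1.
by apply/fsfunP => x; rewrite wbase_mulE fsfun0E mulg1.
Qed.

Lemma wmulVg : left_inverse wone winv wmul.
Proof.
case=> f b; congr pair; last exact: mulVg.
by apply/fsfunP => x; rewrite wbase_mulE wbase_invE fsfun0E mulVg.
Qed.

Lemma wmulgV : right_inverse wone winv wmul.
Proof.
case=> f b; congr pair; last exact: mulgV.
by apply/fsfunP => x; rewrite wbase_mulE wbase_invE fsfun0E mulgK mulgV.
Qed.

End Wreath.

HB.instance Definition _ (A B : groupType) := Choice.on (wreath A B).
HB.instance Definition _ (A B : groupType) :=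
  isGroup.Build (wreath A B) (@wmulA A B) (@wmul1g A B) (@wmulg1 A B)
    (@wmulVg A B) (@wmulgV A B).

Notation Zmul := (Algebra.to_multiplicative int).

Definition ZwrZ : groupType := wreath Zmul Zmul.

(* The generators of the presentation
   $\langle x, y_i \mid x^{-1} y_i x = y_{i+1}, [y_i, y_j] = 1 \rangle$. *)
Definition ZwrZ_x : ZwrZ := ([fsfun], 1%R : int).
Definition ZwrZ_y (i : int) : ZwrZ :=
  ([fsfun u in [fset (i : Zmul)]%fset => (1%R : int)], 1).

Lemma ZwrZ_conj (i : int) : conjg (ZwrZ_y i) ZwrZ_x = ZwrZ_y (i + 1)%R.
Proof.
rewrite -[LHS]/(wmul (winv _) (wmul _ _)).
congr pair.
rewrite /=.
apply/fsfunP => u; rewrite !(wbase_mulE, wbase_invE) fsfun0E invg1 mul1g.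
rewrite fsfun0E mulg1 !fsfunE !inE; congr (if _ then _ else _).
exact: subr_eq.
Qed.

Lemma ZwrZ_comm (i j : int) : commg (ZwrZ_y i) (ZwrZ_y j) = 1.
Proof.
apply/eqP/commgP; rewrite /commute -[LHS]/(wmul _ _) -[RHS]/(wmul _ _).
congr pair.
apply/fsfunP => u; rewrite !wbase_mulE !mulg1; exact: addrC.
Qed.

(* Main.v *)
(** The base group [M] and the top group [B] of a wreath product factorise it
    exactly, so [(a b) o g = a g b] for [a] in [M] and [b] in [B] defines a
    skew left brace whose group [o] is the direct product of [M] and the
    opposite of [B]. For [Z wr Z] this is a free abelian group with one
    generator for each integer, and one more for the top group. The wreath
    product is not nilpotent because the commutator of [f] in [M] with [x] is
    the difference of [f] and a translate of it, which vanishes only for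
    [f = 0] by finiteness of the support. *)
Require Import Defs.
From HB Require Import structures.
From mathcomp Require Import all_boot all_algebra.
From mathcomp Require Import finmap.
From mathcomp Require Import classical_sets cardinality.
From mathcomp.multinomials Require Import freeg.

Set Implicit Arguments.
Unset Strict Implicit.
Unset Printing Implicit Defensive.

Import GRing.Theory.
Local Open Scope classical_set_scope.
Local Open Scope group_scope.

Section WreathBrace.
Variables A B : groupType.
Local Notation W := (wreath A B).
Implicit Types p q r : W.

Lemma wmul1E p q u : (p * q).1 u = p.1 u * q.1 (u * p.2).
Proof. exact: wbase_mulE. Qed.

Lemma winv1E p u : (p^-1).1 u = (p.1 (u * p.2^-1))^-1.
Proof. exact: wbase_invE. Qed.

Lemma wreath_eqP p q : p.1 =1 q.1 -> p.2 = q.2 -> p = q.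
Proof.
by case: p q => [f b] [g c] /= fg ->; congr pair; apply/fsfunP.
Qed.

(** This is [(p.1, 1) * q * (1, p.2)]. *)
Definition wcirc p q : W := (wbase_mul p.1 q.1 1, q.2 * p.2).
Definition wcirc_inv p : W := (wbase_inv p.1 1, p.2^-1).

Lemma wcirc1E p q u : (wcirc p q).1 u = p.1 u * q.1 u.
Proof. by rewrite wbase_mulE mulg1. Qed.

Lemma wcirc_inv1E p u : (wcirc_inv p).1 u = (p.1 u)^-1.
Proof. by rewrite wbase_invE invg1 mulg1. Qed.

Lemma wone1E u : (wone A B).1 u = 1.
Proof. exact: fsfun0E. Qed.

Lemma wcircA : associative wcirc.
Proof.
by move=> p q r; apply: wreath_eqP => [u|]; rewrite ?wcirc1E /= mulgA.
Qed.

Lemma wcirc1g : left_id (wone A B) wcirc.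
Proof.
move=> p; apply: wreath_eqP => [u|]; last exact: mulg1.
by rewrite wcirc1E wone1E mul1g.
Qed.

Lemma wcircg1 : right_id (wone A B) wcirc.
Proof.
move=> p; apply: wreath_eqP => [u|]; last exact: mul1g.
by rewrite wcirc1E wone1E mulg1.
Qed.

Lemma wcircVg : left_inverse (wone A B) wcirc_inv wcirc.
Proof.
move=> p; apply: wreath_eqP => [u|]; last exact: mulgV.
by rewrite wcirc1E wcirc_inv1E wone1E mulVg.
Qed.

Lemma wcircgV : right_inverse (wone A B) wcirc_inv wcirc.
Proof.
move=> p; apply: wreath_eqP => [u|]; last exact: mulVg.
by rewrite wcirc1E wcirc_inv1E wone1E mulgV.
Qed.

(** With [p = a b], where [a] lies in the base and [b] in the top group, the right side is
    [(a q b) (b^-1 a^-1) (a r b)], which telescopes to [a (q r) b]. *)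
Lemma wcirc_brace p q r : wcirc p (q * r) = wcirc p q * p^-1 * wcirc p r.
Proof.
apply: wreath_eqP => [u|].
  rewrite !(wcirc1E, wmul1E, winv1E).
  rewrite -[(wcirc p q * p^-1).2]/(q.2 * p.2 * p.2^-1) -[(wcirc p q).2]/(q.2 * p.2).
  by rewrite -!mulgA mulgV mulg1 !mulgA mulgVK.
by rewrite -[RHS]/(q.2 * p.2 * p.2^-1 * (r.2 * p.2)) mulgK mulgA.
Qed.

HB.instance Definition _ := Group_isSkewBrace.Build W
  wcircA wcirc1g wcircg1 wcircVg wcircgV wcirc_brace.

End WreathBrace.

Lemma commutator_subgroupS (G : groupType) (H K : set G) x y :
  H x -> K y -> commutator_subgroup H K (commg x y).
Proof. by move=> Hx Ky L [_]; apply; exists x, y. Qed.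

(** Projection to [B] is a homomorphism that kills commutators, so its kernel is a subgroup
    containing all of them. *)
Lemma commutator_subgroup_base (A B : groupType) (p : wreath A B) :
  (forall b c : B, commute b c) ->
  commutator_subgroup setT setT p -> p.2 = 1.
Proof.
move=> cB /(_ [set q | q.2 = 1]); apply; split.
  split=> [//|q r /= q1 r1|q /= q1].
    by rewrite -[LHS]/(q.2 * r.2) q1 r1 mulg1.
  by rewrite -[LHS]/(q.2^-1) q1 invg1.
move=> _ [q [r [_ _ ->]]].
by apply/eqP; rewrite -[X in X == _]/(commg q.2 r.2); apply/commgP/cB.
Qed.

Lemma wreath_metabelian (A B : groupType) :
  (forall a b : A, commute a b) -> (forall b c : B, commute b c) ->
  metabelian_group (wreath A B).
Proof.
move=> cA cB p q /(commutator_subgroup_base cB) p1.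
move=> /(commutator_subgroup_base cB) q1.
apply: wreath_eqP => [u|]; first by rewrite !wmul1E p1 q1 mulg1; apply: cA.
exact: cB.
Qed.

Lemma fsfun_translation_invariant (f : {fsfun Zmul -> Zmul with 1}) :
  (forall u : int, f (u + 1)%R = f u) -> f = [fsfun].
Proof.
move=> fP; apply/fsfunP => u; rewrite fsfun0E; apply/eqP/negPn/negP => fu.
have fn n : f (u + n%:Z)%R = f u.
  elim: n => [|n <-]; rewrite ?addr0//.
  by rewrite -[in RHS]fP -addrA -PoszD addn1.
(* One translate of [u] more than the support has points, all in the support. *)
pose s := [seq (u + n%:Z)%R : Zmul | n <- iota 0 #|` finsupp f|.+1].
have : (size s <= #|` finsupp f|)%N.
  apply: uniq_leq_size => [|_ /mapP[n _ ->]]; last by rewrite mem_finsupp fn.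
  by rewrite map_inj_uniq ?iota_uniq// => m n /addrI[].
by rewrite size_map size_iota ltnn.
Qed.

Lemma lower_central_series_ZwrZ n :
  exists2 p : ZwrZ, lower_central_series n p & p.2 = 1 /\ p.1 != [fsfun].
Proof.
elim: n => [|n [p np [p2 p1]]].
  (* Start from a generator of the base; each further commutator with [ZwrZ_x] stays in the base and
     stays nontrivial. *)
  exists (ZwrZ_y 0) => //; split=> //.
  apply/eqP => /fsfunP/(_ 0%R).
  by rewrite /= fsfun0E fsfunE !inE eqxx.
exists (commg p ZwrZ_x); first exact: commutator_subgroupS.
have c2 : (commg p ZwrZ_x).2 = 1.
  by rewrite -[LHS]/(commg p.2 (1%R : int)) p2 comm1g.
split=> //; apply: contraNN p1 => /eqP c1.
(* If [p] commutes with [ZwrZ_x], comparing base components at [u] makes [p.1] invariant under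
   translation by 1. *)
have /eqP/commgP cpx : commg p ZwrZ_x = 1 by apply: wreath_eqP; rewrite ?c1.
apply/eqP/fsfun_translation_invariant => u.
move/(congr1 (fun q : ZwrZ => q.1 u)): cpx.
by rewrite !wmul1E !fsfun0E mul1g mulg1.
Qed.

Lemma ZwrZ_not_nilpotent : ~ nilpotent_group ZwrZ.
Proof.
case=> n nP; have [p] := lower_central_series_ZwrZ n.
by rewrite nP => -> [_]; rewrite eqxx.
Qed.

Local Open Scope ring_scope.

(** [Some u] is the basis element for the generator [ZwrZ_y u], and [None] the one for [ZwrZ_x]. *)
Definition freeg_of_ZwrZ (p : ZwrZ) : {freeg (option int)} :=
  \sum_(u <- finsupp p.1) << (p.1 u : int) *g Some (u : int) >>
    + << (p.2 : int) *g None >>.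

Lemma coeff_freeg_of_ZwrZ (p : ZwrZ) (k : option int) :
  coeff k (freeg_of_ZwrZ p) = if k is Some u then p.1 u else p.2.
Proof.
rewrite /freeg_of_ZwrZ raddfD raddf_sum /= coeffU.
under eq_bigr do rewrite coeffU.
case: k => [u|]; last by rewrite big1 ?add0r ?mulr1// => i _; rewrite mulr0.
(* Inside the support only the term at [u] survives; outside it every term vanishes, as does
   [p.1 u]. *)
rewrite mulr0 addr0; have [us|us] := boolP (u \in finsupp p.1).
  rewrite (bigD1_seq (u : Zmul)) ?fset_uniq//= eqxx mulr1 big1 ?addr0// => v vu.
  by rewrite [_ == _](negbTE vu) mulr0.
rewrite fsfun_dflt// big_seq big1// => v vs.
by rewrite (_ : (_ == _) = false) ?mulr0//; apply: contraNF us => /eqP[<-].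
Qed.

(** [pmap id] drops [None] and strips [Some], leaving a finite set outside which the coefficients
    are 0, the identity of [Zmul]. *)
Definition ZwrZ_of_freeg (D : {freeg (option int)}) : ZwrZ :=
  ([fsfun u in seq_fset tt (pmap id (dom D)) => coeff (Some u) D],
   coeff None D).

Lemma ZwrZ_of_freegE D u : (ZwrZ_of_freeg D).1 u = coeff (Some u) D.
Proof.
rewrite fsfunE seq_fsetE; case: ifPn => // us.
rewrite coeff_outdom//; apply: contraNN us => us.
by rewrite mem_pmap map_id.
Qed.

Lemma ZwrZ_circ_free :
  free_abelian_of_infinite_rank (circ_group (wreath Zmul Zmul)).
Proof.
exists (option int); split.
  have someI : injective (fun n : nat => Some n%:Z) by move=> m n [].
  by move/(finite_preimage (in2W someI))/infinite_nat.
pose f (p : circ_group (wreath Zmul Zmul)) :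
  Algebra.to_multiplicative {freeg (option int)} := freeg_of_ZwrZ p.
have fM : {morph f : p q / (p * q)%g >-> (p * q)%g}.
  move=> p q; apply/eqP/freeg_eqP => k; rewrite [RHS]coeffD.
  rewrite !coeff_freeg_of_ZwrZ; case: k => [u|]; first exact: (wcirc1E p q).
  (* The operation [wcirc] multiplies top components in reverse order. *)
  exact: addrC.
pose F := isMultiplicative.Build _ _ f fM.
pose g : {multiplicative _ -> _} := HB.pack f F.
exists g; exists (ZwrZ_of_freeg : _ -> circ_group (wreath Zmul Zmul)) => [p|D].
  apply: wreath_eqP => [u|]; first by rewrite ZwrZ_of_freegE coeff_freeg_of_ZwrZ.
  exact: (coeff_freeg_of_ZwrZ p None).
apply/eqP/freeg_eqP => k; rewrite coeff_freeg_of_ZwrZ.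
by case: k => [u|//]; rewrite ZwrZ_of_freegE.
Qed.

Theorem proposition5p12 :
  exists G : skewBraceType,
    [/\ group_isomorphic G ZwrZ,
        ~ nilpotent_group G,
        metabelian_group G
      & free_abelian_of_infinite_rank (circ_group G)].
Proof.
exists (wreath Zmul Zmul : skewBraceType); split.
- by exists idfun; exists idfun.
- exact: ZwrZ_not_nilpotent.
- by apply: wreath_metabelian => a b; apply: addrC.
- exact: ZwrZ_circ_free.
Qed.
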